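(* Every locally compact, Baire and $\sigma$-compact $2$-semitopological group is a topological group.
   Context: A semitopological group is a group with a topology making multiplication separately continuous. A topological group is a group with a topology making multiplication jointly continuous and inversion continuous; no separation axiom is assumed. A semitopological group $G$ is a $2$-semitopological group if for every $g\in G$ with $e\notin\overline{\{g\}}$ there is a neighborhood $W$ of the neutral element $e$ with $g\notin W^{2}=WW$. Conventions for a space $X$ (no separation axioms included): $X$ is locally compact if every point has a compact neighborhood; $X$ is $\sigma$-compact if $X=\bigcup_{n\in\mathbb{N}}K_n$ with each $K_n$ compact; $X$ is Baire if whenever $X=\bigcup_{n\in\mathbb{N}}A_n$ there is $n\in\mathbb{N}$ such that the interior of $\overline{A_n}$ is nonempty. *)

(* Defs.v *)
From HB Require Import structures.
From mathcomp Require Import all_boot all_classical topology.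

Set Implicit Arguments.
Unset Strict Implicit.
Unset Printing Implicit Defensive.

Local Open Scope classical_set_scope.

(* A group with a topology, with no compatibility required (named after the
   library's PreTopologicalNmodule). *)
#[short(type="preTopologicalGroupType")]
HB.structure Definition PreTopologicalGroup := {G of Group G & Topological G}.

Section Spaces.
Context (X : topologicalType).

(* The library's [locally_compact] asks for compact neighborhoods that are
   moreover closed; this is stronger in the absence of separation axioms. *)
Definition locally_compact_space :=
  forall x : X, exists2 K : set X, nbhs x K & compact K.

Definition sigma_compact_space :=
  exists2 K : nat -> set X,
    forall n, compact (K n) & \bigcup_n K n = [set: X].

Definition baire_space :=
  forall A : nat -> set X, \bigcup_n A n = [set: X] ->
    exists n, interior (closure (A n)) !=set0.

End Spaces.

Section Groups.
Context (G : preTopologicalGroupType).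
Local Open Scope group_scope.

Definition semitopological_group :=
  (forall a : G, continuous (fun x : G => a * x)) /\
  (forall a : G, continuous (fun x : G => x * a)).

Definition topological_group :=
  continuous (fun p : G * G => p.1 * p.2) /\ continuous (fun x : G => x^-1).

Definition two_semitopological_group :=
  semitopological_group /\
  forall g : G, ~ closure [set g] 1 ->
    exists2 W : set G, nbhs (1 : G) W & ~ [set x * y | x in W & y in W] g.

End Groups.

(* Main.v *)
Require Import Defs.
From mathcomp Require Import all_boot all_classical topology.

(* Let [core] be the intersection of the neighborhoods of 1, a normal
   subsemigroup. The 2-condition says that a point [g] outside [core] is not in
   [W W] for some neighborhood [W], that is, [g W^-1] misses [W]; hence
   [(core K)^-1] is closed for every compact [K]. By sigma-compactness and the
   Baire property some neighborhood of 1 is contained in such a set. Compactness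
   then makes [core] a group and, applied to the compact sets [K \ V], makes
   inversion continuous, so that [g W] and [W] are disjoint neighborhoods and the
   space is regular.

   Joint continuity is Ellis's theorem. Let [V1] be a neighborhood of 1 with
   [closure V1 <= V2 <= C <= V], [V2] open and [C] compact and closed. A
   Namioka-style choice of sequences shows that the points [a] with
   [a W W <= C] for some neighborhood [W] are dense in [V1]. The intersection of
   the compact sets [a^-1 C] over these [a] is contained in [C], hence in the
   interior of [V], so finitely many of them already intersect inside [V], and
   the corresponding [W] satisfy [W W <= V]. *)

Set Implicit Arguments.
Unset Strict Implicit.
Unset Printing Implicit Defensive.

Local Open Scope classical_set_scope.

(** * Cluster points in compact sets *)

Lemma compact_directed (T : topologicalType) (I : Type) (D : set I)
    (B : I -> set T) (K : set T) :
  compact K ->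
  (forall i j, D i -> D j -> exists2 k, D k & B k `<=` B i `&` B j) ->
  (forall i, D i -> B i !=set0) ->
  (exists2 i, D i & B i `<=` K) ->
  exists2 x, K x & forall i, D i -> closure (B i) x.
Proof.
move=> cK dirB B0 [i0 Di0 Bi0].
have FF : Filter (filter_from D B) by apply: filter_from_filter => //; exists i0.
have PF : ProperFilter (filter_from D B) by exact: filter_from_proper.
have [|x [Kx clx]] := cK (filter_from D B) PF; first by exists i0.
by exists x => // i Di U Ux; apply: clx => //; exists i.
Qed.

Lemma compact_seq_cluster (T : topologicalType) (u : nat -> T) (K : set T) :
  compact K -> (forall n, K (u n)) ->
  exists2 x, K x & forall U n, nbhs x U -> exists2 m, n < m & U (u m).
Proof.
move=> cK Ku.
have [|||x Kx clx] := @compact_directed T nat setT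
    (fun n => u @` [set m | n < m]) K cK.
- move=> i j _ _; exists (maxn i j) => // _ [m /= ijm <-].
  by move: ijm; rewrite gtn_max => /andP[im jm]; split; exists m.
- by move=> n _; exists (u n.+1), n.+1 => /=.
- by exists 0 => // _ [m _ <-].
exists x => // U n Ux; have [_ [[m nm <-] Um]] := clx n I U Ux.
by exists m.
Qed.

Section SeparatelyContinuous.
Context (G : preTopologicalGroupType) (sG : semitopological_group G).
Local Open Scope group_scope.

Lemma nbhs_mull (a x : G) (U : set G) :
  nbhs (a * x) U -> nbhs x [set y | U (a * y)].
Proof. exact: sG.1. Qed.

Lemma nbhs_mulr (a x : G) (U : set G) :
  nbhs (x * a) U -> nbhs x [set y | U (y * a)].
Proof. exact: sG.2. Qed.

Lemma nbhs_translate (a x : G) (U : set G) :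
  nbhs x U -> nbhs (a * x) [set y | U (a^-1 * y)].
Proof. by move=> Ux; apply: nbhs_mull; rewrite mulKg. Qed.

(** * Ellis's theorem: joint continuity at the neutral element *)

Section ChoiceSequence.
Context (L V1 V2 C : set G).
Hypotheses (cL : compact L) (L1 : nbhs (1 : G) L) (V1L : V1 `<=` L).
Hypotheses (V12 : closure V1 `<=` V2) (oV2 : open V2).
Hypotheses (cC : closed C) (V2C : V2 `<=` C).

(* Otherwise one chooses [a_n] and [y_n] with [a_n y_m] in [V1] and [a_m y_n]
   outside [C] for [n < m]; for cluster points [a] and [y], the iterated limits
   put [a y] in [closure V1] and outside [V2]. *)
Lemma locally_mul_subset (O : set G) : open O -> O !=set0 -> O `<=` V1 ->
  exists a O' W, [/\ O a, nbhs a O', nbhs (1 : G) W &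
    forall x w, O' x -> W w -> C (x * w)].
Proof.
move=> oO [o0 Oo0] OV1; apply: contrapT => noO'.
(* [p.1] holds the points still allowed for the next [a_n], [p.2] those for the next [y_n]. *)
pose good (p : set G * set G) :=
  [/\ open p.1, p.1 !=set0, p.1 `<=` O, nbhs (1 : G) p.2 & p.2 `<=` L].
have choose (p : set G * set G) : exists q : G * G,
    good p -> [/\ p.1 q.1, p.2 q.2 & ~ C (q.1 * q.2)].
  apply: contrapT => noq; apply: noO'.
  have [gp|ngp] := pselect (good p); last by case: noq; exists (1, 1).
  have [op [a pa] pO p1 pL] := gp.
  exists a, p.1, p.2; split=> //; first exact: pO.
    exact: open_nbhs_nbhs.
  move=> x w px pw; apply: contrapT => nC; apply: noq; exists (x, w).
  by split.
have [sel selP] := boolp.choice choose.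
(* Every later [a_m] must have [a_m y_n] outside [C], every later [y_m] must have [a_n y_m] in
   [V1]. *)
pose next (p : set G * set G) : set G * set G :=
  (p.1 `&` [set z | ~ C (z * (sel p).2)], p.2 `&` [set w | V1 ((sel p).1 * w)]).
have good_next p : good p -> good (next p).
  move=> gp; have [op _ pO p1 pL] := gp; have [px pw nC] := selP p gp.
  have V1x : nbhs ((sel p).1 * 1) V1.
    rewrite mulg1; apply: (@filterS _ _ _ p.1); last exact: open_nbhs_nbhs.
    by move=> z pz; apply/OV1/pO.
  split=> /=.
  - apply: openI => //; rewrite openE => z nCz; apply: (@nbhs_mulr _ _ (~` C)).
    by apply: open_nbhs_nbhs; split=> //; exact: closed_openC.
  - by exists (sel p).1.
  - by move=> z [/pO].
  - by apply: filterI => //; exact: nbhs_mull.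
  - by move=> z [/pL].
pose p n := iter n next (O, L).
have good_p n : good (p n).
  by elim: n => [|n IHn] /=; [split=> //; exists o0|exact: good_next].
have sub_p m n : n <= m -> (p m).1 `<=` (p n).1 /\ (p m).2 `<=` (p n).2.
  elim: m => [|m IHm]; first by rewrite leqn0 => /eqP ->; split.
  rewrite leq_eqVlt => /predU1P[->|]; first by split.
  rewrite ltnS => /IHm[IH1 IH2] /=.
  by split=> z [/= pz _]; [exact: IH1|exact: IH2].
pose a n := (sel (p n)).1; pose y n := (sel (p n)).2.
have ay_notC n m : n < m -> ~ C (a m * y n).
  by move=> /sub_p[/= sp _]; have [/sp[_ nC] _ _] := selP _ (good_p m).
have ay_V1 n m : n < m -> V1 (a n * y m).
  by move=> /sub_p[_ /= sp]; have [_ /sp[_ V1y] _] := selP _ (good_p m).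
have aL n : L (a n).
  by have [_ _ pO _ _] := good_p n; have [/pO /OV1 /V1L La _ _] := selP _ (good_p n).
have yL n : L (y n).
  by have [_ _ _ _ pL] := good_p n; have [_ /pL Ly _] := selP _ (good_p n).
have [a0 _ cla] := compact_seq_cluster cL aL.
have [y0 _ cly] := compact_seq_cluster cL yL.
have a_y0 n : closure V1 (a n * y0).
  move=> U /nbhs_mull /(cly _ n)[m nm Uy].
  by exists (a n * y m); split=> //; exact: ay_V1.
have a0_y0 : closure V1 (a0 * y0).
  apply: (@closed_closure _ V1).
  move=> U /nbhs_mulr /(cla _ 0)[m _ Ua].
  by exists (a m * y0).
have /nbhs_mull /(cly _ 0)[n _ V2y] : nbhs (a0 * y0) V2.
  by apply: open_nbhs_nbhs; split=> //; exact: V12.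
have /nbhs_mulr /(cla _ n)[m nm V2a] : nbhs (a0 * y n) V2.
  by apply: open_nbhs_nbhs.
exact: ay_notC nm (V2C V2a).
Qed.

End ChoiceSequence.

Lemma mul_continuous1 (V : set G) :
  (forall U, nbhs (1 : G) U ->
    exists2 U', nbhs (1 : G) U' & closure U' `<=` U) ->
  locally_compact_space G -> nbhs (1 : G) V ->
  exists2 W, nbhs (1 : G) W & forall x y, W x -> W y -> V (x * y).
Proof.
move=> regG lcG V1nb.
have [L L1 cL] := lcG 1.
have [C0 C01 C0VL] : exists2 U, nbhs (1 : G) U & closure U `<=` V° `&` L.
  apply: regG; apply: filterI => //.
  by apply: open_nbhs_nbhs; split; [exact: open_interior|].
have [U0 U01 U0C] : exists2 U, nbhs (1 : G) U & closure U `<=` C0°.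
  by apply: regG; apply: open_nbhs_nbhs; split; [exact: open_interior|].
(* In [locally_mul_subset], [U] plays the part of [V1] and [C0°] that of [V2]. *)
set C := closure C0; set U := U0°.
have cC : closed C by exact: closed_closure.
have CV : C `<=` V by move=> x /C0VL[/interior_subset].
have U1 : nbhs (1 : G) U.
  by apply: open_nbhs_nbhs; split; [exact: open_interior|].
have UC : closure U `<=` C0° by move=> x /(closureS (@interior_subset _ U0)) /U0C.
have C0C : C0° `<=` C by move=> x /interior_subset; exact: subset_closure.
have UL : U `<=` L by move=> x /subset_closure /UC /C0C /C0VL[].
pose E := [set a | exists2 W, nbhs (1 : G) W &
  forall x y, W x -> W y -> C (a * (x * y))].
have denseE (O : set G) : nbhs (1 : G) O -> exists2 a, O a & E a.
  move=> O1; have [|||a [O' [W [[/interior_subset Oa _] aO' W1 CO'W]]]] :=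
    @locally_mul_subset L U C0° C cL L1 UL UC (@open_interior _ _) cC C0C (O° `&` U).
  - by apply: openI; exact: open_interior.
  - by exists 1; split; [exact: nbhs_singleton (nbhs_interior O1)|exact: nbhs_singleton].
  - by move=> x [].
  exists a => //; exists ([set x | O' (a * x)] `&` W).
    by apply: filterI => //; apply: nbhs_mull; rewrite mulg1.
  by move=> x y [O'x _] [_ Wy]; rewrite mulgA; exact: CO'W.
apply: contrapT => noW.
(* A single [a1] in [E] confines the products from [W0] to the compact set [a1^-1 C]. *)
have [a1 _ [W0 W01 CW0]] := denseE _ filterT.
pose B W := [set z | exists x y, [/\ W x, W y, z = x * y & ~ V z]].
have cK : compact [set a1^-1 * c | c in C].
  apply: continuous_compact; first by apply: continuous_subspaceT; exact: sG.1.
  by apply: (subclosed_compact cC cL) => x /C0VL[].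
have [||| g _ clg] := @compact_directed G (set G) (nbhs (1 : G)) B _ cK.
- move=> W W' Wn W'n; exists (W `&` W'); first exact: filterI.
  by move=> _ [x [y [[Wx W'x] [Wy W'y] -> nV]]]; split; exists x, y.
- move=> W Wn; apply: contrapT => BW0; apply: noW; exists W => // x y Wx Wy.
  by apply: contrapT => nV; apply: BW0; exists (x * y), x, y.
- exists W0 => // _ [x [y [Wx Wy -> _]]].
  by exists (a1 * (x * y)); [exact: CW0|rewrite mulKg].
have CEg a : E a -> C (a * g).
  move=> [W Wn CW]; apply: cC => N /nbhs_mull Ng.
  have [_ [[x [y [Wx Wy -> _]]] Nxy]] := clg W Wn _ Ng.
  by exists (a * (x * y)); split=> //; exact: CW.
(* Points of [E] come arbitrarily close to 1, and [C] is closed. *)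
have Cg : C g.
  rewrite -[g]mul1g; apply: cC => N /nbhs_mulr /denseE[a Na Ea].
  by exists (a * g); split=> //; exact: CEg.
have [_ [[x [y [_ _ -> nV]]] /interior_subset Vxy]] : B setT `&` V° !=set0.
  apply: clg; first exact: filterT.
  by apply: open_nbhs_nbhs; split; [exact: open_interior|have [] := C0VL _ Cg].
exact: nV.
Qed.


(** * The core and continuity of inversion *)

Definition core : set G := [set h | forall U, nbhs (1 : G) U -> U h].

Lemma core1 : core 1.
Proof. by move=> U /nbhs_singleton. Qed.

Lemma core_mull h x U : core h -> nbhs x U -> U (h * x).
Proof. by move=> Hh Ux; apply: (Hh [set y | U (y * x)]); apply: nbhs_mulr; rewrite mul1g. Qed.

Lemma core_mulr h x U : core h -> nbhs x U -> U (x * h).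
Proof. by move=> Hh Ux; apply: (Hh [set y | U (x * y)]); apply: nbhs_mull; rewrite mulg1. Qed.

Lemma coreM g h : core g -> core h -> core (g * h).
Proof.
move=> Hg Hh U U1.
by apply: (core_mulr Hh (U := U)); move: (nbhs_interior U1); exact: Hg.
Qed.

Lemma core_conj h x : core h -> core (x * h * x^-1).
Proof.
move=> Hh U U1; apply: (core_mulr Hh (U := [set y | U (y * x^-1)])).
by apply: nbhs_mulr; rewrite mulgV.
Qed.

Lemma core_conjE h x : core (x * h * x^-1) -> core h.
Proof. by move=> /(core_conj x^-1); rewrite invgK !mulgA mulVg mul1g mulgVK. Qed.

(** The 2-condition: 1 lies in the closure of [[set g]] exactly when [g] lies in [core]. *)
Hypothesis ts : forall g : G, ~ core g ->
  exists2 W, nbhs (1 : G) W & forall x y, W x -> W y -> g <> x * y.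

(* The inverses of the elements of [core * K]. *)
Definition coreV (K : set G) : set G :=
  [set x | exists2 k, K k & core (x^-1 * k^-1)].

Lemma closed_coreV (K : set G) : compact K -> closed (coreV K).
Proof.
move=> cK x clx.
pose B U := [set k | K k /\ exists2 u, U u & core (u^-1 * k^-1)].
have [||| k Kk clk] := @compact_directed G (set G) (nbhs x) B K cK.
- move=> U U' Ux U'x; exists (U `&` U'); first exact: filterI.
  by move=> k [Kk [u [Uu U'u] Hu]]; split; split=> //; exists u.
- by move=> U /clx[u [[k Kk Hk] Uu]]; exists k; split=> //; exists u.
- by exists setT; [exact: filterT|move=> k []].
exists k => //; apply: contrapT => /ts[W W1 Wxk].
have Wn : nbhs (1 : G) W° by exact: nbhs_interior.
have Ux : nbhs x [set u | W° (x^-1 * u)] by apply: nbhs_mull; rewrite mulVg.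
have Uk : nbhs k [set z | W° (z * k^-1)] by apply: nbhs_mulr; rewrite mulgV.
have [k' [[_ [u Wu Hu]] Wk']] := clk _ Ux _ Uk.
(* In [x^-1 k^-1 = (x^-1 u) (u^-1 k'^-1) (k' k^-1)] the middle factor is in [core], so the open set
   [W°] absorbs it. *)
apply: (Wxk (x^-1 * u) ((u^-1 * k'^-1) * (k' * k^-1))).
- exact: interior_subset.
- exact: core_mull.
- by rewrite !mulgA mulgVK mulgK.
Qed.

Lemma inv_nbhs_compact : baire_space G -> sigma_compact_space G ->
  exists2 K : set G, compact K & nbhs (1 : G) (coreV K).
Proof.
move=> bG [K cK KT].
have [|n [u /= nu]] := bG (fun n => coreV (K n)).
  apply/seteqP; split=> // x _.
  have [n _ Kx] : (\bigcup_n K n) x^-1 by rewrite KT.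
  by exists n => //; exists x^-1 => //; rewrite mulgV; exact: core1.
(* Left translation by [u^-1] moves the interior point [u] to 1 and turns [coreV (K n)] into [coreV]
   of [K n] translated by [u]. *)
exists [set k * u | k in K n].
  by apply: continuous_compact => //; apply: continuous_subspaceT; exact: sG.2.
have {nu} : nbhs u (coreV (K n)).
  by apply: filterS nu => x; exact: closed_coreV.
rewrite -{1}[u]mulg1 => /nbhs_mull; apply: filterS => x [k Kk Hk].
by exists (k * u); [exists k|move: Hk; rewrite !invgM mulgA].
Qed.

(* By compactness some [m] in [K] lies in the closure of every [x] in [core^-1];
   taking [x = m h^-1] and conjugating by [m] gives [h^-1] in [core]. *)
Lemma coreV_core (K : set G) h :
  compact K -> nbhs (1 : G) (coreV K) -> core h -> core h^-1.
Proof.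
move=> cK K1 Hh.
pose B x := [set k | K k /\ core (x * k^-1)].
have [||| m Km clm] := @compact_directed G G [set x | core x^-1] B K cK.
(* [B (x * y)] lies in [B x] by normality of [core], and in [B y] because [x^-1] is in [core]. *)
- move=> x y /= Hx Hy; exists (x * y); first by rewrite /= invgM; exact: coreM.
  move=> k [Kk Hk]; split; split=> //.
    have -> : x * k^-1 = (x * y * k^-1) * (k * y^-1 * k^-1).
      by rewrite !mulgA mulgVK mulgK.
    by apply: coreM => //; exact: core_conj.
  have -> : y * k^-1 = x^-1 * (x * y * k^-1) by rewrite -!mulgA mulKg.
  exact: coreM.
- move=> x /= Hx; have [k Kk Hk] := Hx _ K1.
  by exists k; split=> //; rewrite invgK in Hk.
- by exists 1; [rewrite /= invg1; exact: core1|move=> k []].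
have Hm x : core x^-1 -> core (x * m^-1).
  move=> Hx V V1.
  have /nbhs_interior Vm : nbhs m [set z | V (z * m^-1)].
    by apply: nbhs_mulr; rewrite mulgV.
  have [k [[_ Hk] Vk]] := clm x Hx _ Vm.
  by have := core_mull Hk Vk; rewrite mulgVK.
have Hm1 : core m^-1 by rewrite -[m^-1]mul1g; apply: Hm; rewrite invg1; exact: core1.
by apply: (@core_conjE _ m); apply: Hm; rewrite invgM invgK; exact: coreM.
Qed.

Hypotheses (bG : baire_space G) (scG : sigma_compact_space G).

Lemma coreV1 h : core h -> core h^-1.
Proof. by have [K cK K1] := inv_nbhs_compact bG scG; exact: (coreV_core cK K1). Qed.

(** From the neighborhood [coreV K] one removes the closed set [coreV (K \ V°)], which misses 1
    because [core] is closed under inverses. The inverses of the remaining points lie in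
    [core * V°], hence in [V]. *)
Lemma nbhs_inv1 (V : set G) : nbhs (1 : G) V -> nbhs (1 : G) [set x | V x^-1].
Proof.
move=> V1; have [K cK K1] := inv_nbhs_compact bG scG.
have cKV : compact (K `&` ~` V°).
  by apply: compact_closedI => //; apply: open_closedC; exact: open_interior.
have nKV : nbhs (1 : G) (~` coreV (K `&` ~` V°)).
  apply: open_nbhs_nbhs; split.
    by apply: closed_openC; exact: closed_coreV.
  move=> [k [_ nVk]]; rewrite invg1 mul1g => /coreV1; rewrite invgK => Hk.
  by apply: nVk; apply: Hk; exact: nbhs_interior.
apply: filterS (filterI K1 nKV) => x [[k Kk Hk] nx].
have Vk : nbhs k V.
  by apply: contrapT => nVk; apply: nx; exists k.
by have := core_mull Hk Vk; rewrite mulgVK.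
Qed.

Lemma inv_continuous : continuous (fun x : G => x^-1).
Proof.
move=> a V Va; have /nbhs_mulr /nbhs_inv1 V1 : nbhs (1 * a^-1) V by rewrite mul1g.
have : nbhs (a^-1 * a) [set x | V (x^-1 * a^-1)] by rewrite mulVg.
by move=> /nbhs_mull; apply: filterS => x /=; rewrite invgM invgK mulgK.
Qed.

(** * Regularity at the neutral element *)

Hypothesis lcG : locally_compact_space G.

Lemma nbhs_closure1 (V : set G) : nbhs (1 : G) V ->
  exists2 U, nbhs (1 : G) U & closure U `<=` V.
Proof.
move=> V1; have [K K1 cK] := lcG 1.
apply: contrapT => noU.
pose B U := K `&` closure U `&` ~` V°.
have [||| y Ky cly] := @compact_directed G (set G) (nbhs (1 : G)) B K cK.
- move=> U U' U1 U'1; exists (U `&` U'); first exact: filterI.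
  by move=> k [[Kk /closureI[Uk U'k]] nVk].
- move=> U U1; apply: contrapT => BU0; apply: noU.
  exists (U `&` K); first exact: filterI.
  move=> x /closureI[Ux Kx]; apply: contrapT => nVx.
  (* [K] may fail to be closed, but its closure lies in [core * K]; so [x] can be replaced by a
     point [k] of [K]. *)
  have [k Kk Hk] : coreV K x^-1.
    apply: closed_coreV => // N /inv_continuous /Kx[k [Kk Nk]].
    by exists k^-1; split=> //; exists k => //; rewrite invgK mulgV; exact: core1.
  rewrite invgK in Hk.
  apply: BU0; exists k; split; first split=> //.
    move=> N /nbhs_interior Nk.
    apply: Ux; have := core_mull Hk Nk; rewrite mulgVK; exact.
  by move=> Vk; apply: nVx; have := core_mull Hk Vk; rewrite mulgVK.
- by exists setT; [exact: filterT|move=> k [[]]].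
have nVy : (~` V°) y.
  apply: open_closedC; first exact: open_interior.
  by move=> N /(cly _ filterT)[k [[_ nVk] Nk]]; exists k.
have /ts[W W1 Wy] : ~ core y by move=> Hy; apply: nVy; apply: Hy; exact: nbhs_interior.
(* This neighborhood [y W^-1] of [y] misses [W], although [y] is in [closure W]. *)
have : nbhs y [set z | W (z^-1 * y)].
  have : nbhs (y^-1 * y) [set z | W z^-1] by rewrite mulVg; exact: nbhs_inv1.
  by move=> /nbhs_mull; apply: filterS => z /=; rewrite invgM invgK.
have Wcl : closure W y.
  apply: closed_closure => N /(cly _ W1)[k [[[_ Wk] _] Nk]]; by exists k.
by move=> /Wcl[z [Wz Wzy]]; apply: (Wy z (z^-1 * y)) => //; rewrite mulVKg.
Qed.

End SeparatelyContinuous.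

Theorem theorem3p8 (G : preTopologicalGroupType) :
  locally_compact_space G -> baire_space G -> sigma_compact_space G ->
  two_semitopological_group G -> topological_group G.
Proof.
move=> lcG bG scG [sG ts2].
have ts (g : G) : ~ core g ->
    exists2 W, nbhs (1%g : G) W & forall x y, W x -> W y -> g <> (x * y)%g.
  move=> nHg; have [|W W1 nW] := ts2 g.
    move=> clg; apply: nHg => U /clg[_ [-> //]].
  by exists W => // x y Wx Wy gE; apply: nW; exists x => //; exists y.
split; last exact: inv_continuous.
move=> [a b] O /= Oab.
(* Pulled back along [z |-> a z b], [O] becomes a neighborhood of 1; it contains some [W W], so
   [(a W) (W b)] lies in [O]. *)
have : nbhs (a * 1 * b)%g O by rewrite mulg1.
move=> /(nbhs_mulr sG) /(nbhs_mull sG) O1.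
have [W W1 WO] := mul_continuous1 sG (nbhs_closure1 sG ts bG scG lcG) lcG O1.
exists ([set x | W (a^-1 * x)%g], [set y | W (y * b^-1)%g]) => /=.
  split; first by apply: (nbhs_mull sG); rewrite mulVg.
  by apply: (nbhs_mulr sG); rewrite mulgV.
move=> [x y] /= [Wx Wy]; have /= := WO _ _ Wx Wy.
by rewrite !mulgA mulgV mul1g mulgVK.
Qed.
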